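(* Let $M$ be a delta-matroid over a finite ground set $V$, and let $v\in V$. Then the equicardinal set systems $\min(M)$, $\min(M*v)$, and $\mathrm{minc}(M\mathbin{\bar{*}}v)$ are such that precisely two of the three are equal, to say $M_1$. Moreover, the third, $M_2$, is such that $d_{M_2}=d_{M_1}+1$ and $M_2\mathbin{\widehat{/}}v=M_1$. In particular, the values of $d_M$, $d_{M*v}$, and $d_{M\bar{*}v}$ are such that precisely two of the three are equal, to say $m$, and the third is equal to $m+1$.
   Context: A set system is a pair $M=(V,D)$ with $V$ a finite set (the ground set) and $D$ a family of subsets of $V$; it is proper if $D\neq\varnothing$. We write $Y\in M$ for $Y\in D$. $\triangle$ denotes symmetric difference. A set system is equicardinal if all its sets have the same cardinality. A delta-matroid is a proper set system $M$ satisfying the symmetric exchange axiom: for all $X,Y\in M$ and all $u\in X\triangle Y$, either $X\triangle\{u\}\in M$ or there is a $w\in X\triangle Y$ with $w\neq u$ such that $X\triangle\{u,w\}\in M$. For $v\in V$: the pivot of $M$ on $v$ is $M*v=(V,\{Y\triangle\{v\}\mid Y\in D\})$; the dual pivot of $M$ on $v$ is $M\mathbin{\bar{*}}v=(V,D\triangle\{Z\setminus\{v\}\mid Z\in D,\ v\in Z\})$; the pseudo-contraction of $M$ on $v$ is $M\mathbin{\widehat{/}}v=(V,\{Z\setminus\{v\}\mid Z\in D,\ v\in Z\})$ (with ground set still $V$). $\min(M)$ is the set system on $V$ consisting of the members of $D$ that are minimal with respect to inclusion; $\mathrm{minc}(M)$ is the set system on $V$ consisting of the members of $D$ of minimum cardinality.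 For a proper set system $M$, $d_M=\min\{|Y|\mid Y\in M\}$ is the cardinality of a smallest set in $M$. *)

(* Defs.v *)
From mathcomp Require Import all_boot.

Set Implicit Arguments.
Unset Strict Implicit.
Unset Printing Implicit Defensive.

(* A set system (V, D) is represented by its family D; the ground set V is the
   finite type itself, so every operation below keeps the ground set. *)
Notation set_system V := {set {set V}}.

Definition symdiff (T : finType) (A B : {set T}) : {set T} :=
  (A :\: B) :|: (B :\: A).

Section SetSystems.

Variable V : finType.
Implicit Types (M : set_system V) (v : V).

Definition proper_system M : Prop := M != set0.

Definition equicardinal M : Prop :=
  forall X Y : {set V}, X \in M -> Y \in M -> #|X| = #|Y|.

Definition delta_matroid M : Prop :=
  proper_system M /\
  forall (X Y : {set V}) (u : V), X \in M -> Y \in M -> u \in symdiff X Y ->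
    symdiff X [set u] \in M \/
    exists w : V, [/\ w \in symdiff X Y, w != u & symdiff X [set u; w] \in M].

Definition pivot M v : set_system V := [set symdiff Y [set v] | Y in M].

Definition pseudo_contraction M v : set_system V :=
  [set Z :\ v | Z in M & v \in Z].

Definition dual_pivot M v : set_system V :=
  symdiff M (pseudo_contraction M v).

Definition min_system M : set_system V := [set X | minset [in M] X].

Definition minc_system M : set_system V :=
  [set X in M | [forall Y in M, #|X| <= #|Y|]].

(* The neutral element #|V| bounds every #|Y|, so this is the minimum for proper
   M; the value #|V| for the empty family is a dummy. *)
Definition dmin M : nat := \big[minn/#|V|]_(Y in M) #|Y|.

End SetSystems.

(* Precisely two of a, b, c are equal, their common value being x, and the
   third one is y. *)
Definition two_of_three (T : Type) (a b c x y : T) : Prop :=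
  x <> y /\
  [\/ [/\ a = x, b = x & c = y],
      [/\ a = x, c = x & b = y] |
      [/\ b = x, c = x & a = y]].

(* Main.v *)
Require Import Defs.
From mathcomp Require Import all_boot.

(** Let [k] be the least cardinality of [Z :\ v] over [Z] in [M]. Besides sets
  of size at least [k + 1], the systems [M], [M * v] and the dual pivot consist
  of the size-[k] families [P], [Q] and the symmetric difference of [P] and [Q],
  where [P] and [Q] collect the [X] of size [k] avoiding [v] with [X \in M],
  respectively [v |: X \in M].
  At least one of [P], [Q] is nonempty, and the exchange axiom forces [P = Q]
  when both are. So exactly one of the three families is empty and the other two
  coincide. In the system with the empty family, the sets of size [k + 1]
  containing [v] are exactly the [v |: X] with [X] in the common family.
  Minimal members have minimum cardinality: exchanging a strictly smaller
  member towards a minimal one [X] never enlarges it, and ends with a proper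
  subset of [X]. *)

Set Implicit Arguments.
Unset Strict Implicit.
Unset Printing Implicit Defensive.

Section DeltaMatroids.

Variable V : finType.
Implicit Types (M N : set_system V) (X Y Z : {set V}) (u v w : V).

(** * Symmetric difference as exclusive or, and membership in the pivoted systems *)

Lemma in_symdiff (T : finType) (A B : {set T}) x :
  (x \in symdiff A B) = (x \in A) (+) (x \in B).
Proof. by rewrite !inE; case: (x \in A); case: (x \in B). Qed.

Lemma symdiffK Y : involutive ((@symdiff V)^~ Y).
Proof. by move=> X; apply/setP=> x; rewrite !in_symdiff addbK. Qed.

Lemma symdiffAC X Y Z : symdiff (symdiff X Y) Z = symdiff (symdiff X Z) Y.
Proof. by apply/setP=> x; rewrite !in_symdiff addbAC. Qed.

Lemma symdiff_cancel X Y Z : symdiff (symdiff X Z) (symdiff Y Z) = symdiff X Y.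
Proof. by apply/setP=> x; rewrite !in_symdiff addbACA addbb addbF. Qed.

Lemma symdiff1 X v : symdiff X [set v] = if v \in X then X :\ v else v |: X.
Proof.
apply/setP=> x; rewrite in_symdiff !inE.
by case vX: (v \in X); rewrite !inE; case: (eqVneq x v) => [->|_];
   rewrite ?vX ?addbF.
Qed.

Lemma setD1_notin X v : v \notin X -> X :\ v = X.
Proof. by move=> vX; apply/setDidPl; rewrite disjoint_sym disjoints1. Qed.

Lemma symdiffC X Y : symdiff X Y = symdiff Y X.
Proof. exact: setUC. Qed.

Lemma symdiff0 X : symdiff X set0 = X.
Proof. by rewrite /symdiff setD0 set0D setU0. Qed.

Lemma symdiff_self X : symdiff X X = set0.
Proof. by rewrite /symdiff setDv setU0. Qed.

Lemma in_pivot M v X : (X \in pivot M v) = (symdiff X [set v] \in M).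
Proof.
apply/imsetP/idP => [[Y YM ->]|XM]; first by rewrite symdiffK.
by exists (symdiff X [set v]); rewrite ?symdiffK.
Qed.

Lemma pivotK v : involutive ((@pivot V)^~ v).
Proof. by move=> M; apply/setP=> X; rewrite !in_pivot symdiffK. Qed.

Lemma in_pseudo_contraction M v X :
  (X \in pseudo_contraction M v) = (v \notin X) && (v |: X \in M).
Proof.
apply/imsetP/andP => [[Z]|[vX XM]].
  by rewrite inE => /andP[ZM vZ] ->; rewrite setD11 setD1K.
by exists (v |: X); rewrite ?setU1K // inE XM setU11.
Qed.

Lemma in_dual_pivot M v X :
  (X \in dual_pivot M v) = (X \in M) (+) ((v \notin X) && (v |: X \in M)).
Proof. by rewrite in_symdiff in_pseudo_contraction. Qed.

(** * Exchange arguments inside a delta-matroid *)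

Lemma pivot_delta_matroid M v : delta_matroid M -> delta_matroid (pivot M v).
Proof.
case=> /set0Pn[X0 X0M] exch; split.
  by apply/set0Pn; exists (symdiff X0 [set v]); rewrite in_pivot symdiffK.
move=> X Y u; rewrite !in_pivot => XM YM uXY.
have := exch _ _ u XM YM; rewrite symdiff_cancel symdiffAC => /(_ uXY).
case=> [|[w [wXY wu XuwM]]]; first by left.
by right; exists w; split=> //; rewrite in_pivot symdiffAC.
Qed.

(** Exchange at [u], sorted by its partner: with no partner or one in [Y], elements are only lost;
    with one in [X], the size is kept. The strict decrease of the distance to [X] lets a closest
    member replace iterated exchange. *)
Lemma delta_matroid_step M X Y u :
    delta_matroid M -> X \in M -> Y \in M -> u \in Y -> u \notin X ->
  exists2 Y', Y' \in M & #|symdiff Y' X| < #|symdiff Y X| /\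
    (Y' \subset Y :\ u \/
     exists2 w, w \in X & w \notin Y /\ Y' = w |: (Y :\ u)).
Proof.
move=> [_ exch] XM YM uY uX.
have uYX : u \in symdiff Y X by rewrite in_symdiff uY (negbTE uX).
have closer (W : {set V}) : u \in W -> W \subset symdiff Y X ->
    #|symdiff (symdiff Y W) X| < #|symdiff Y X|.
  move=> uW sW; rewrite symdiffAC; apply: proper_card; apply/properP; split.
    apply/subsetP=> x; rewrite in_symdiff.
    by case xW: (x \in W); rewrite ?addbF // (subsetP sW).
  by exists u; rewrite // in_symdiff uYX uW.
case: (exch Y X u YM XM uYX) => [YuM|[w [wYX wu YuwM]]].
  exists (symdiff Y [set u]) => //; split; first by rewrite closer ?set11 ?sub1set.
  by left; rewrite symdiff1 uY.
exists (symdiff Y [set u; w]) => //; split.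
  by rewrite closer ?set21 // subUset !sub1set uYX.
case wY: (w \in Y).
  left; apply/subsetP=> x; rewrite in_symdiff !inE.
  case: (eqVneq x u) => [->|_] /=; first by rewrite uY.
  by case: (eqVneq x w) => [->|_]; rewrite ?wY ?addbF.
right; exists w; first by move: wYX; rewrite in_symdiff wY.
split; first by rewrite wY.
apply/setP=> x; rewrite in_symdiff !inE.
case: (eqVneq x u) => [->|xu] /=; first by rewrite uY (eq_sym u) (negbTE wu).
by case: (eqVneq x w) => [->|_]; rewrite ?wY ?addbF.
Qed.

Lemma card_exchange Y u w : u \in Y -> w \notin Y -> #|w |: (Y :\ u)| = #|Y|.
Proof.
by move=> uY wY; rewrite cardsU1 !inE (negbTE wY) andbF (cardsD1 u Y) uY.
Qed.

Lemma minset_card_le M X Y :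
  delta_matroid M -> minset [in M] X -> Y \in M -> #|X| <= #|Y|.
Proof.
move=> dM /minsetP[XM Xmin] YM; rewrite leqNgt; apply/negP=> ltYX.
have Y0P : (Y \in M) && (#|Y| < #|X|) by rewrite YM.
case: (@arg_minnP _ Y (fun Z => (Z \in M) && (#|Z| < #|X|))
        (fun Z => #|symdiff Z X|) Y0P) => Z /andP[ZM ltZX] Zclosest.
case: (boolP (Z \subset X)) => [sZX|/subsetPn[u uZ uX]].
  by move: ltZX; rewrite (Xmin Z ZM sZX) ltnn.
have [Z' Z'M [closer Z'P]] := delta_matroid_step dM XM ZM uZ uX.
move: closer; rewrite ltnNge Zclosest // Z'M.
apply: leq_ltn_trans ltZX; case: Z'P => [/subset_leq_card le|[w wX [wZ ->]]].
  exact: leq_trans le (subset_leq_card (subsetDl _ _)).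
by rewrite card_exchange.
Qed.

Lemma min_system_minc M : delta_matroid M -> min_system M = minc_system M.
Proof.
move=> dM; apply/setP=> X; rewrite !inE; apply/idP/andP => [Xmin|[XM /forall_inP Xmin]].
  split; first by case/minsetP: Xmin.
  by apply/forall_inP=> Y; apply: minset_card_le.
apply/minsetP; split=> // Y YM sYX; apply/eqP; rewrite eqEcard sYX.
exact: Xmin.
Qed.

(** Take [Z] closest to [X] among the members containing [v] of size [#|X|.+1]. If [Z] leaves
    [v |: X] at some [u], exchange at [u]: losing elements breaks the lower bound, and a swap keeps
    [v] and the size but comes closer. *)
Lemma delta_matroid_setU1 M v X Y :
    delta_matroid M -> (forall Z, Z \in M -> #|X| <= #|Z :\ v|) ->
    X \in M -> v \notin X -> Y \in M -> v \in Y -> #|Y| = #|X|.+1 ->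
  v |: X \in M.
Proof.
move=> dM kM XM vX YM vY cY.
have YP : [&& Y \in M, v \in Y & #|Y| == #|X|.+1] by rewrite YM vY cY eqxx.
case: (@arg_minnP _ Y (fun Z => [&& Z \in M, v \in Z & #|Z| == #|X|.+1])
        (fun Z => #|symdiff Z X|) YP) => Z /and3P[ZM vZ /eqP cZ] Zclosest.
case: (boolP (Z \subset v |: X)) => [sZX|/subsetPn[u uZ]].
  suff <- : Z = v |: X by [].
  by apply/eqP; rewrite eqEcard sZX cardsU1 vX cZ /=.
rewrite !inE negb_or => /andP[uv uX].
have [Z' Z'M [closer [sZ'|[w wX [wZ defZ']]]]] := delta_matroid_step dM XM ZM uZ uX.
  (* Here [Z' :\ v] lies in [Z] without [u] and [v], which has [#|X| - 1] elements. *)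
  have := leq_trans (kM _ Z'M) (subset_leq_card (setSD [set v] sZ')).
  move: cZ; rewrite (cardsD1 u Z) uZ (cardsD1 v (Z :\ u)) !inE (eq_sym v) uv vZ.
  by move=> -[<-]; rewrite ltnn.
move: closer; rewrite ltnNge Zclosest // Z'M defZ' card_exchange // cZ eqxx andbT.
by rewrite !inE (eq_sym v u) uv vZ orbT.
Qed.

(** * Members of a fixed size, and the minimum cardinality *)

Definition level N k : set_system V := [set X in N | #|X| == k].

Lemma in_level N k X : (X \in level N k) = (X \in N) && (#|X| == k).
Proof. by rewrite inE. Qed.

Lemma level_proper N k : level N k != set0 -> N != set0.
Proof.
case/set0Pn=> X; rewrite in_level => /andP[XN _].
by apply/set0Pn; exists X.
Qed.

Lemma dmin_eq N k :
  (forall X, X \in N -> k <= #|X|) -> level N k != set0 -> dmin N = k.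
Proof.
move=> kN /set0Pn[X]; rewrite in_level => /andP[XN /eqP cX].
apply/eqP; rewrite eqn_leq; apply/andP; split.
  rewrite -cX /dmin; elim: (index_enum _) (mem_index_enum X) => // Y r IHr.
  rewrite in_cons big_cons => /predU1P[<-|/IHr leX]; first by rewrite XN geq_minl.
  by case: ifP => // _; rewrite geq_min leX orbT.
rewrite /dmin; elim/big_ind: _ => [|x y xk yk|Y /kN //].
  (* The default value [#|V|] of the minimum is also at least [k]. *)
  by rewrite -cX max_card.
by rewrite leq_min xk.
Qed.

Lemma minc_eq N k :
  (forall X, X \in N -> k <= #|X|) -> level N k != set0 ->
  minc_system N = level N k.
Proof.
move=> kN /set0Pn[Y]; rewrite in_level => /andP[YN /eqP cY].
apply/setP=> X; rewrite in_level inE; case XN: (X \in N) => //=.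
apply/forall_inP/eqP => [Xmin|-> //].
by apply/eqP; rewrite eqn_leq kN // -cY Xmin.
Qed.

Lemma level_idem N k : level (level N k) k = level N k.
Proof. by apply/setP=> X; rewrite !in_level -andbA andbb. Qed.

Lemma dmin_minc N k :
  (forall X, X \in N -> k <= #|X|) -> level N k != set0 ->
  dmin (minc_system N) = k.
Proof.
move=> kN N0; rewrite (minc_eq kN N0) (@dmin_eq _ k) ?level_idem // => X.
by rewrite in_level => /andP[_ /eqP->].
Qed.

Lemma equicardinal_minc N : equicardinal (minc_system N).
Proof.
move=> X Y; rewrite !inE => /andP[XN /forall_inP Xmin] /andP[YN /forall_inP Ymin].
by apply/eqP; rewrite eqn_leq Xmin // Ymin.
Qed.

(** Stated for abstract systems because each of the three can be the exceptional [C]. The last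
    hypothesis also makes level [k.+1] of [C] nonempty, so that the minimum of [C] is exactly
    [k.+1]. *)
Lemma minc_two_of_three (A B C : set_system V) v k :
    (forall X, X \in A -> k <= #|X|) -> (forall X, X \in B -> k <= #|X|) ->
    (forall X, X \in C -> k <= #|X|) ->
    level A k != set0 -> level B k = level A k -> level C k = set0 ->
    pseudo_contraction (level C k.+1) v = level A k ->
  [/\ minc_system B = minc_system A,
      dmin (minc_system C) = dmin (minc_system A) + 1,
      pseudo_contraction (minc_system C) v = minc_system A,
      minc_system A <> minc_system C &
      [/\ dmin A = k, dmin B = k, dmin C = k + 1 & C != set0]].
Proof.
move=> kA kB kC A0 eqBA C0 CA.
have B0 : level B k != set0 by rewrite eqBA.
have kC1 X : X \in C -> k.+1 <= #|X|.
  move=> XC; rewrite ltn_neqAle kC // andbT; apply: contraTneq XC => kX.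
  by have/setP/(_ X) := C0; rewrite in_level kX eqxx andbT inE => ->.
have C1 : level C k.+1 != set0.
  case/set0Pn: A0 => X; rewrite -CA in_pseudo_contraction => /andP[_ XC].
  by apply/set0Pn; exists (v |: X).
have C'0 := level_proper C1.
have neq : minc_system A <> minc_system C.
  by move/(congr1 (@dmin V))/eqP; rewrite (dmin_minc kA) // (dmin_minc kC1) // ltn_eqF.
split=> //; last split=> //.
all: by rewrite ?(dmin_minc kA, dmin_minc kC1, minc_eq kA, minc_eq kB, minc_eq kC1,
             dmin_eq kA, dmin_eq kB, dmin_eq kC1) // addn1.
Qed.

Lemma pseudo_contraction_level N v k X :
  (X \in pseudo_contraction (level N k.+1) v) =
  [&& v \notin X, #|X| == k & v |: X \in N].
Proof.
rewrite in_pseudo_contraction in_level cardsU1.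
by case: (v \in X); rewrite //= add1n eqSS andbC.
Qed.

(** One inclusion suffices: the pivot is an involution that preserves the exchange axiom and the
    bound on [#|Z :\ v|]. *)
Lemma level_pivot_eq M v k X Y :
    delta_matroid M -> (forall Z, Z \in M -> k <= #|Z :\ v|) ->
    X \in level M k -> Y \in level (pivot M v) k ->
  level (pivot M v) k = level M k.
Proof.
have notin N Z : (forall Z, Z \in N -> k <= #|Z :\ v|) -> Z \in level N k ->
    [/\ Z \in N, v \notin Z & #|Z| = k].
  rewrite in_level => kN /andP[ZN /eqP cZ]; split=> //; apply/negP=> vZ.
  by have := kN Z ZN; rewrite -cZ (cardsD1 v Z) vZ ltnn.
have sub N Z0 : delta_matroid N -> (forall Z, Z \in N -> k <= #|Z :\ v|) ->
    (forall Z, Z \in pivot N v -> k <= #|Z :\ v|) ->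
    Z0 \in level (pivot N v) k -> level N k \subset level (pivot N v) k.
  move=> dN kN kN' /(notin _ _ kN')[]; rewrite in_pivot symdiff1.
  move=> + vZ cZ; rewrite (negbTE vZ) => ZN.
  apply/subsetP=> Z /(notin _ _ kN)[Z'N vZ' cZ'].
  rewrite in_level cZ' eqxx andbT in_pivot symdiff1 (negbTE vZ').
  (* [Z0] is in the pivot and avoids [v], so [v |: Z0] is a member of [N] of size [k.+1]. *)
  apply: (@delta_matroid_setU1 N v Z (v |: Z0)) => //; rewrite ?setU11 //.
    by rewrite cZ'.
  by rewrite cardsU1 vZ cZ cZ'.
move=> dM kM XM YM.
have kM' Z : Z \in pivot M v -> k <= #|Z :\ v|.
  rewrite in_pivot => /kM; rewrite symdiff1.
  by case: ifPn => [_|vZ]; rewrite ?setDDl ?setUid ?setU1K // => /leq_trans->;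
    rewrite // -{1}(setD1_notin vZ).
apply/eqP; rewrite eqEsubset (sub M Y) // andbT -{2}(pivotK v M).
by apply: (sub _ X); rewrite ?pivotK //; apply: pivot_delta_matroid.
Qed.

End DeltaMatroids.

Theorem theorem5p5 (V : finType) (M : set_system V) (v : V) :
  delta_matroid M ->
  [/\ equicardinal (min_system M),
      equicardinal (min_system (pivot M v)),
      equicardinal (minc_system (dual_pivot M v)) &
      exists M1 M2 : set_system V,
        [/\ two_of_three (min_system M) (min_system (pivot M v))
              (minc_system (dual_pivot M v)) M1 M2,
            dmin M2 = dmin M1 + 1 &
            pseudo_contraction M2 v = M1]] /\
  [/\ proper_system M, proper_system (pivot M v),
      proper_system (dual_pivot M v) &
      exists m : nat,
        two_of_three (dmin M) (dmin (pivot M v)) (dmin (dual_pivot M v))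
          m (m + 1)].
Proof.
move=> dM; have dM' := pivot_delta_matroid v dM.
have [M0 _] := dM; have [M'0 _] := dM'.
have /set0Pn[Z0 Z0M] := M0.
(* From here on only cardinalities matter in all three systems. *)
rewrite !min_system_minc //.
case: (@arg_minnP _ Z0 [in M] (fun Z => #|Z :\ v|) Z0M) => Z /= ZM.
have [k cZ] : exists k, #|Z :\ v| = k by exists #|Z :\ v|.
rewrite cZ => kM.
have leM (X : {set V}) : X \in M -> k <= #|X|.
  by move/kM/leq_trans; apply; apply: subset_leq_card (subsetDl _ _).
have leM1 (X : {set V}) : v \notin X -> v |: X \in M -> k <= #|X|.
  by move=> vX /kM; rewrite setU1K.
have leP (X : {set V}) : X \in pivot M v -> k <= #|X|.
  rewrite in_pivot symdiff1; case: ifPn => [_ /leM|/leM1]; last exact.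
  by move/leq_trans; apply; apply: subset_leq_card (subsetDl _ _).
have leD (X : {set V}) : X \in dual_pivot M v -> k <= #|X|.
  rewrite in_dual_pivot; case XM: (X \in M) => /=; first by rewrite leM.
  by case/andP; apply: leM1.
have kNv (X : {set V}) : v \in X -> #|X| == k -> X \notin M.
  move=> vX /eqP cX; apply/negP=> /kM; rewrite -cX (cardsD1 v X) vX.
  by rewrite ltnn.
have kNv' (X : {set V}) : v \in X -> #|X| == k -> X :\ v \notin M.
  move=> vX /eqP cX; apply/negP=> /leM; rewrite -cX (cardsD1 v X) vX.
  by rewrite ltnn.
(* If [X] of size [k] contains [v], then [X :\ v] is too small to be in [M]; otherwise both sides
   are the same exclusive or. *)
have lD : level (dual_pivot M v) k
          = symdiff (level M k) (level (pivot M v) k).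
  apply/setP=> X; rewrite in_symdiff !in_level in_dual_pivot in_pivot symdiff1.
  case cX: (_ == k); rewrite ?andbF ?andbT //; case vX: (v \in X) => //=.
  by rewrite (negbTE (kNv' X vX cX)).
(* This identity and the next two give the contraction hypothesis of [minc_two_of_three] for each
   choice of [C]. *)
have lMp : level M k = pseudo_contraction (level (pivot M v) k.+1) v.
  apply/setP=> X; rewrite pseudo_contraction_level in_level in_pivot symdiff1.
  rewrite setU11; case cX: (_ == k); rewrite ?andbF ?andbT //.
  by case: (boolP (v \in X)) => vX /=; rewrite ?setU1K ?(negbTE (kNv X vX cX)).
have lPp : level (pivot M v) k = pseudo_contraction (level M k.+1) v.
  apply/setP=> X; rewrite pseudo_contraction_level in_level in_pivot symdiff1.
  case cX: (_ == k); rewrite ?andbF ?andbT //.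
  by case: (boolP (v \in X)) => vX //=; rewrite (negbTE (kNv' X vX cX)).
have lPd : level (pivot M v) k
           = pseudo_contraction (level (dual_pivot M v) k.+1) v.
  rewrite lPp; apply/setP=> X; rewrite !pseudo_contraction_level in_dual_pivot.
  by rewrite setU11 addbF.
(* The minimizer [Z], with [v] removed, is a witness in one of the two systems. *)
have l0 : (level M k != set0) || (level (pivot M v) k != set0).
  case: (boolP (v \in Z)) => vZ; apply/orP; [right|left]; apply/set0Pn.
    exists (Z :\ v); rewrite in_level in_pivot symdiff1 setD11 setD1K // ZM.
    exact/eqP.
  by exists Z; rewrite in_level ZM -cZ setD1_notin // eqxx.
have neqm m : m <> m + 1 by apply/eqP; rewrite addn1 ltn_eqF.
(* First case: [M] is the exceptional system. *)
case: (eqVneq (level M k) set0) l0 => [P0|P0] /= Q0.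
  have [|eqm dm pc neq [dB dA dC _]] :=
    minc_two_of_three leP leD leM Q0 _ P0 (esym lPp).
    by rewrite lD P0 symdiffC symdiff0.
  have D0 : dual_pivot M v != set0.
    by apply: (@level_proper _ _ k); rewrite lD P0 symdiffC symdiff0.
  split; split=> //; try exact: equicardinal_minc.
    exists (minc_system (pivot M v)), (minc_system M); split=> //.
    by split=> //; apply: Or33; split.
  by exists k; split; last by apply: Or33; split.
(* Second case: the pivot is exceptional. *)
case: (eqVneq (level (pivot M v) k) set0) => [{}Q0|{}Q0].
  have [|eqm dm pc neq [dA dB dC _]] :=
    minc_two_of_three leM leD leP P0 _ Q0 (esym lMp).
    by rewrite lD Q0 symdiff0.
  have D0 : dual_pivot M v != set0.
    by apply: (@level_proper _ _ k); rewrite lD Q0 symdiff0.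
  split; split=> //; try exact: equicardinal_minc.
    exists (minc_system M), (minc_system (pivot M v)); split=> //.
    by split=> //; apply: Or32; split.
  by exists k; split; last by apply: Or32; split.
(* Both levels are nonempty, hence equal; they cancel in the dual pivot, which is exceptional. *)
have eqQP : level (pivot M v) k = level M k.
  by case/set0Pn: P0 Q0 => X XP /set0Pn[Y]; apply: level_pivot_eq XP.
have [||eqm dm pc neq [dA dB dC D0]] :=
  @minc_two_of_three _ M (pivot M v) (dual_pivot M v) v k leM leP leD P0 eqQP.
- by rewrite lD eqQP symdiff_self.
- by rewrite -lPd.
split; split=> //; try exact: equicardinal_minc.
  exists (minc_system M), (minc_system (dual_pivot M v)); split=> //.
  by split=> //; apply: Or31; split.
by exists k; split; last by apply: Or31; split.
Qed.
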